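(* Let $(M,g)$ be an $n$-dimensional Riemannian manifold, $n\geq 3$, possibly with boundary, with $g\in C^r$, $r>2$, and set $p=\frac{2n}{n-2}$. Let $Z=(Z^1,\ldots,Z^n)$ be coordinates on an open set $\Omega\subset M$. Then $Z$ are conformal harmonic coordinates on $\Omega$ if and only if there is a function $f>0$ on $\Omega$ such that $Z$ are harmonic coordinates with respect to the conformal metric $f^{p-2}g$ and the scalar curvature of this metric vanishes, $R(f^{p-2}g)=0$.
   Context: $\Delta_gu=-|g|^{-1/2}\partial_a(|g|^{1/2}g^{ab}\partial_bu)$ with $|g|=\det(g_{ab})$, $R(g)$ is the scalar curvature, and $L_g=\Delta_g+\frac{n-2}{4(n-1)}R(g)$. Functions $f,f^k$ are understood to be $C^2$. Coordinates $(Z^1,\ldots,Z^n)$ are harmonic with respect to a metric $\tilde g$ if $\Delta_{\tilde g}Z^k=0$ for $k=1,\ldots,n$. Conformal harmonic coordinates on $\Omega$: coordinates $(Z^1,\ldots,Z^n)$ on $\Omega$ such that $Z^k=f^k/f$, $k=1,\ldots,n$, for some functions $f^k$ and $f>0$ on $\Omega$ with $L_gf^k=L_gf=0$ on $\Omega$. If $\Omega$ meets $\partial M$, coordinates near boundary points are boundary coordinate systems, i.e. they map into $\{x^n\geq 0\}$ and map $\Omega\cap\partial M$ into $\{x^n=0\}$. If $g$ is $C^r$, the atlas has $C^{r+1}$ transition functions and $g$ is $C^r$ up to the boundary. *)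

(* Defs.v *)
From HB Require Import structures.
From mathcomp Require Import all_boot all_order all_algebra.
From mathcomp Require Import all_classical all_reals all_analysis.

Set Implicit Arguments.
Unset Strict Implicit.
Unset Printing Implicit Defensive.

Import Order.TTheory GRing.Theory Num.Theory.
Import numFieldNormedType.Exports.

Local Open Scope classical_set_scope.
Local Open Scope ring_scope.

(* Manifolds with boundary of finite differentiability, as maximal atlases on a
   topological space. Tensor calculus is done in coordinates: a coordinate
   expression is a function of a chart and of a point of its domain, and it is
   evaluated in all charts of the atlas. *)

(* {x^n >= 0}; the coordinate x^n is the one with index n - 1. *)
Definition half_space (R : realType) (n : nat) : set 'rV[R]_n :=
  [set y | forall i : 'I_n, i.+1 = n -> 0 <= y ord0 i].
Arguments half_space : clear implicits.

(* The image is open in R^n (interior chart) or relatively open in the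
   half-space (boundary chart). In an atlas with C^1 transition functions, a
   point sent by some boundary chart into {x^n = 0} is a boundary point; every
   chart around it is then a boundary chart sending it into {x^n = 0}.
   The values of [chart_map] off the domain, and those of [chart_inv] off the
   image, are irrelevant. *)
Record chart (R : realType) (n : nat) (M : topologicalType) := Chart {
  chart_dom : set M;
  chart_map :> M -> 'rV[R]_n;
  chart_inv : 'rV[R]_n -> M;
  chart_img := chart_map @` chart_dom;
  chart_dom_open : open chart_dom;
  chart_mapK : {in chart_dom, cancel chart_map chart_inv};
  chart_map_cont : {within chart_dom, continuous chart_map};
  chart_inv_cont : {within chart_img, continuous chart_inv};
  chart_img_open : open chart_img \/
    exists2 V : set 'rV[R]_n, open V & chart_img = V `&` half_space R n
}.

Section Calculus.
Context {R : realType} {n : nat} {M : topologicalType}.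
Implicit Types (phi psi : chart R n M) (W : set M) (u : M -> R) (x : M).

Definition diff_quotient phi (a : 'I_n) u x (t : R) : R :=
  (u (chart_inv phi (phi x + t *: delta_mx ord0 a)) - u x) / t.

(* Nonzero increments that stay in the image of the chart; for a = n at a
   boundary point this makes the derivative one-sided. *)
Definition increments phi (a : 'I_n) x : set_system R :=
  within [set t | chart_img phi (phi x + t *: delta_mx ord0 a)] (0 : R)^'.

Definition has_partial phi a u x : Prop :=
  cvg (diff_quotient phi a u x @ increments phi a x).

(* The function du/dx^a, where x^1, ..., x^n are the coordinates of phi. *)
Definition partial phi a u x : R :=
  lim (diff_quotient phi a u x @ increments phi a x).

Definition locally_holder phi W (alpha : R) u : Prop :=
  forall x, W x -> exists2 V : set M, nbhs x V &
    exists C : R, forall y z, V y -> W y -> V z -> W z ->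
      `|u y - u z| <= C * (`|phi y - phi z| `^ alpha).

(* u is C^{k,alpha} on W, locally and up to the boundary, in the chart phi. *)
Fixpoint holder_class phi W (k : nat) (alpha : R) u : Prop :=
  {within W, continuous u} /\
  match k with
  | 0 => locally_holder phi W alpha u
  | k'.+1 => forall a, (forall x, W x -> has_partial phi a u x) /\
                       holder_class phi W k' alpha (partial phi a u)
  end.

(* C^s for real s >= 0: C^{k,alpha} with s = k + alpha, 0 <= alpha < 1. For
   alpha = 0 the Hoelder condition is local boundedness (0 `^ 0 = 1), which
   follows from continuity, so that C^{k,0} is the usual C^k. *)
Definition chart_class phi W (s : R) u : Prop :=
  holder_class phi W (Num.truncn s) (s - (Num.truncn s)%:R) u.

(* The transition function psi o phi^-1 is of class C^s. *)
Definition smooth_transition (s : R) phi psi : Prop :=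
  forall i : 'I_n, chart_class phi (chart_dom phi `&` chart_dom psi) s
    (fun x => psi x ord0 i).

Definition jacobian phi psi x : 'M[R]_n :=
  \matrix_(i, a) partial phi a (fun y => psi y ord0 i) x.

End Calculus.

Definition is_manifold (R : realType) (n : nat) (M : topologicalType) (s : R)
    (A : set (chart R n M)) : Prop :=
  [/\ hausdorff_space M /\ @second_countable M,
      forall x, exists2 phi, A phi & chart_dom phi x,
      forall phi psi, A phi -> A psi -> smooth_transition s phi psi
    & forall psi, (forall phi, A phi ->
        smooth_transition s phi psi /\ smooth_transition s psi phi) -> A psi].

Section Geometry.
Context {R : realType} {n : nat} {M : topologicalType}.
Implicit Types (A : set (chart R n M)) (phi psi : chart R n M).
Implicit Types (Omega : set M) (u : M -> R) (x : M).

(* [g phi x] is the matrix (g_ab) at x of a covariant 2-tensor field in the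
   coordinates phi. *)
Definition tensor2 := chart R n M -> M -> 'M[R]_n.

Implicit Types (g : tensor2).

Definition riemannian_metric A (r : R) g : Prop :=
  [/\ forall phi x, A phi -> chart_dom phi x -> (g phi x)^T = g phi x,
      forall phi x (v : 'rV[R]_n), A phi -> chart_dom phi x -> v != 0 ->
        0 < (v *m g phi x *m v^T) ord0 ord0,
      forall phi psi x, A phi -> A psi ->
        chart_dom phi x -> chart_dom psi x ->
        g phi x = (jacobian phi psi x)^T *m g psi x *m jacobian phi psi x
    & forall phi (a b : 'I_n), A phi ->
        chart_class phi (chart_dom phi) r (fun x => g phi x a b)].

Definition conformal_metric (c : M -> R) g : tensor2 :=
  fun phi x => c x *: g phi x.

Section Coordinates.
Variables (g : tensor2) (phi : chart R n M).

(* g^{ab} *)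
Definition ginv (a b : 'I_n) x : R := invmx (g phi x) a b.

(* |g|^{1/2} *)
Definition vol x : R := Num.sqrt (\det (g phi x)).

Definition laplacian u x : R :=
  - ((vol x)^-1 * \sum_(a < n)
       partial phi a
         (fun y => vol y * \sum_(b < n) ginv a b y * partial phi b u y) x).

(* Gamma^c_ab *)
Definition christoffel (c a b : 'I_n) x : R :=
  2^-1 * \sum_(d < n) ginv c d x *
    (partial phi a (fun y => g phi y b d) x
     + partial phi b (fun y => g phi y a d) x
     - partial phi d (fun y => g phi y a b) x).

(* R^d_cab, defined by R(d_a, d_b) d_c = R^d_cab d_d with
   R(X, Y) = [nabla_X, nabla_Y] - nabla_[X, Y]. *)
Definition riemann (d c a b : 'I_n) x : R :=
  partial phi a (christoffel d b c) x - partial phi b (christoffel d a c) x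
  + \sum_(e < n) (christoffel d a e x * christoffel e b c x
                  - christoffel d b e x * christoffel e a c x).

(* The trace of X |-> R(X, d_b) d_c, so that round spheres have positive
   curvature. *)
Definition ricci (c b : 'I_n) x : R := \sum_(a < n) riemann a c a b x.

Definition scalar_curvature x : R :=
  \sum_(c < n) \sum_(b < n) ginv c b x * ricci c b x.

Definition conformal_laplacian u x : R :=
  laplacian u x
  + (n%:R - 2) / (4 * (n%:R - 1)) * scalar_curvature x * u x.

End Coordinates.

(* A scalar field, given by its expression F phi in each chart phi, vanishes
   on Omega. *)
Definition vanishes A Omega (F : chart R n M -> M -> R) : Prop :=
  forall phi x, A phi -> Omega x -> chart_dom phi x -> F phi x = 0.

Definition class_on A Omega (s : R) u : Prop :=
  forall phi, A phi -> chart_class phi (Omega `&` chart_dom phi) s u.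

(* By maximality of the atlas, its elements are all the admissible coordinate
   systems. *)
Definition coordinates_on A Omega (Z : chart R n M) : Prop :=
  A Z /\ chart_dom Z = Omega.

Definition harmonic_coordinates A g Omega (Z : chart R n M) : Prop :=
  coordinates_on A Omega Z /\
  forall k : 'I_n,
    vanishes A Omega (fun phi => laplacian g phi (fun x => Z x ord0 k)).

Definition conformal_harmonic_coordinates A g Omega (Z : chart R n M) : Prop :=
  coordinates_on A Omega Z /\
  exists (F : 'I_n -> M -> R) (f : M -> R),
    [/\ class_on A Omega 2 f /\ (forall k, class_on A Omega 2 (F k)),
        forall x, Omega x -> 0 < f x,
        forall k x, Omega x -> Z x ord0 k = F k x / f x,
        forall k, vanishes A Omega (fun phi => conformal_laplacian g phi (F k))
      & vanishes A Omega (fun phi => conformal_laplacian g phi f)].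

End Geometry.

Arguments tensor2 : clear implicits.

(* Main.v *)
Require Import Defs.
From mathcomp Require Import all_boot all_order all_algebra.
From mathcomp Require Import all_classical all_reals all_analysis.
From mathcomp Require Import perm ring.

Import Order.TTheory GRing.Theory Num.Theory.
Import numFieldNormedType.Exports.

Local Open Scope classical_set_scope.
Local Open Scope ring_scope.

(** Put q = p - 2 = 4 / (n - 2), c = f^q and g~ = c g. Two transformation laws
    for the conformal change from g to g~ carry the proof:

      (n - 2) / (4 (n - 1)) f c R(g~) = L_g f,
      c f^2 Delta_g~ u = f Delta_g (f u) - f u Delta_g f.

    Since f and c are positive, the first one says that R(g~) = 0 if and only
    if L_g f = 0. The zeroth-order terms of f L_g (f u) - f u L_g f cancel, so
    the right-hand side of the second one is also f L_g (f u) - f u L_g f; when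
    L_g f = 0, u is therefore harmonic for g~ if and only if L_g (f u) = 0.
    Both directions follow by taking u = Z^k and F^k = f Z^k; in the direction
    that produces F^k, its regularity holds because products of C^2 functions
    are C^2 and the coordinates Z^k are of class C^(r+1).

    Both laws are pointwise identities in a single chart. The first
    ([scalar_curvature_conformal]) compares Christoffel symbols: with
    w_a = d_a c / (2 c) = (q / 2) d_a f / f, those of g~ differ from those of g
    by the tensor delta^c_a w_b + delta^c_b w_a - g_ab w^c. The contribution of
    this tensor to the scalar curvature is an identity between finite sums,
    [conformal_curvature_trace]:

      c R(g~) = R(g) - 2 (n - 1) div w - (n - 1) (n - 2) |w|^2.

    The value of q is the one for which the terms quadratic in df cancel once
    div w is expressed through Delta_g f. The second law
    ([laplacian_conformal]) holds because c^n = (c f^2)^2, which makes the flux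
    |g~|^(1/2) g~^ab d_b u equal to f^2 |g|^(1/2) g^ab d_b u.

    Partial derivatives are limits of difference quotients along coordinate
    lines of a chart, one-sided at the boundary; the computations use their
    product rule, chain rule and locality. Second derivatives only enter
    contracted with the symmetric matrix g^ab, so the order of differentiation
    does not matter. Differentiability of |g|^(1/2) rests on det g > 0, which
    is [posdef_det_gt0]. *)
Set Implicit Arguments.
Unset Strict Implicit.
Unset Printing Implicit Defensive.

(** * Partial derivatives at one point of a chart *)

Section PartialCalculus.
Context {R : realType} {n : nat} {M : topologicalType}.
Variables (phi : chart R n M) (a : 'I_n) (x : M).
Hypothesis phix : chart_dom phi x.
Implicit Types (u v : M -> R) (W : set M).

Local Notation ray t := (phi x + t *: delta_mx ord0 a).

Lemma ray_cvg : ray t @[t --> (0 : R)] --> phi x.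
Proof.
have : phi x + (t *: delta_mx ord0 a : 'rV[R]_n) @[t --> (0 : R)] -->
   phi x + (0 : R) *: (delta_mx ord0 a : 'rV[R]_n).
  by apply: cvgD; [exact: cvg_cst | apply: cvgZr_tmp; exact: cvg_id].
by rewrite scale0r addr0.
Qed.

#[local] Instance increments_filter : Filter (increments phi a x).
Proof. exact: within_filter. Qed.

Lemma increments_neq0 : \forall t \near increments phi a x, t != 0.
Proof.
rewrite /increments near_withinE; near=> t => _.
by near: t; exact: nbhs_dnbhs_neq.
Unshelve. all: by end_near. Qed.

(** Moving in a nonnegative direction does not leave the half-space, so even at
    a boundary point small positive increments are admissible; this is what
    makes [increments] a proper filter there. *)
Lemma near_right_img : \forall t \near (0 : R)^'+, chart_img phi (ray t).
Proof.
have phix_img : chart_img phi (phi x) by exists x.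
have ray_right (V : set 'rV[R]_n) : open V -> V (phi x) ->
    \forall t \near (0 : R)^'+, V (ray t).
  move=> oV Vx; apply: cvg_within.
  exact: (ray_cvg (open_nbhs_nbhs (conj oV Vx))).
case: (chart_img_open phi) => [oI|[V oV imgE]]; first exact: ray_right.
move: phix_img; rewrite imgE => -[Vx Hx].
near=> t; split; first by near: t; exact: ray_right.
move=> i ni; rewrite !mxE; apply: addr_ge0; first exact: Hx.
by rewrite mulr_ge0 ?ler0n.
Unshelve. all: by end_near. Qed.

Lemma increments_proper : ProperFilter (increments phi a x).
Proof.
have right_filter : ProperFilter (0 : R)^'+ by exact: at_right_proper_filter.
apply: Build_ProperFilter => F0.
have PR : \forall t \near (0 : R)^'+, ~ chart_img phi (ray t).
  have PR0 : \forall t \near (0 : R), t != 0 -> ~ chart_img phi (ray t).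
    exact: F0.
  rewrite /at_right near_withinE; apply: filterS PR0 => t H t0.
  by apply: H; exact: lt0r_neq0.
suff : \forall t \near (0 : R)^'+, False by case/filter_ex.
by move: PR near_right_img; apply: filterS2.
Qed.

(** The inverse of the chart is continuous on the image only, hence the
    restriction to increments that stay in the image. *)
Lemma near_increments_dom W : open W -> W x ->
  \forall t \near increments phi a x, W (chart_inv phi (ray t)).
Proof.
move=> oW Wx.
have phix_img : chart_img phi (phi x) by exists x.
have xE : chart_inv phi (phi x) = x by apply: chart_mapK; rewrite inE.
have : nbhs (phi x : subspace (chart_img phi)) (chart_inv phi @^-1` W).
  have Wphix : nbhs (chart_inv phi (phi x)) W.
    by rewrite xE; exact: open_nbhs_nbhs.
  exact: (@chart_inv_cont _ _ _ phi _ _ Wphix).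
rewrite -[nbhs _]nbhs_subspace_in// => H.
have H0 : \forall t \near (0 : R), chart_img phi (ray t) ->
    W (chart_inv phi (ray t)) by exact: (ray_cvg H).
rewrite /increments near_withinE /dnbhs near_withinE.
by apply: filterS H0 => t Ht _; exact: Ht.
Qed.

(** A relational form of [partial]: it states existence and value at once, so
    that the rules below compose without side conditions. *)
Definition is_partial u (l : R) : Prop :=
  diff_quotient phi a u x @ increments phi a x --> l.

Lemma is_partialE u l : is_partial u l -> partial phi a u x = l.
Proof. by move=> ul; apply: cvg_lim => //; exact: increments_proper. Qed.

Lemma is_partial_ex u l : is_partial u l -> has_partial phi a u x.
Proof. by move=> ul; apply/cvg_ex; exists l. Qed.

Lemma has_partialP u :
  has_partial phi a u x -> is_partial u (partial phi a u x).
Proof. by []. Qed.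

(** A partial derivative at x depends only on the values near x. *)
Lemma is_partial_local W u v l : open W -> W x ->
  (forall y, W y -> u y = v y) -> is_partial u l -> is_partial v l.
Proof.
move=> oW Wx uv; apply: cvg_trans; apply: near_eq_cvg.
near=> t; rewrite /diff_quotient /=.
have Wt : W (chart_inv phi (ray t)) by near: t; exact: near_increments_dom.
by rewrite (uv _ Wt) (uv _ Wx).
Unshelve. all: by end_near. Qed.

Lemma is_partial_cst (k : R) : is_partial (fun=> k) 0.
Proof.
rewrite /is_partial; suff -> : diff_quotient phi a (fun=> k) x = fun=> 0.
  exact: cvg_cst.
by apply/funext => t; rewrite /diff_quotient subrr mul0r.
Qed.

Lemma is_partialD u v l m : is_partial u l -> is_partial v m ->
  is_partial (fun y => u y + v y) (l + m).
Proof.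
move=> ul vm; rewrite /is_partial.
have -> : diff_quotient phi a (fun y => u y + v y) x =
    (fun t => diff_quotient phi a u x t + diff_quotient phi a v x t).
  by apply/funext => t; rewrite /diff_quotient -mulrDl opprD addrACA.
exact: cvgD.
Qed.

(** Continuity along the coordinate line, which the product and chain rules
    need: u differs from u x by t times a convergent difference quotient. *)
Lemma is_partial_along u l : is_partial u l ->
  u (chart_inv phi (ray t)) @[t --> increments phi a x] --> u x.
Proof.
move=> ul.
have id0 : (t : R) @[t --> increments phi a x] --> (0 : R).
  by apply: cvg_within_filter; apply: cvg_within_filter; exact: cvg_id.
have : u x + diff_quotient phi a u x t * t @[t --> increments phi a x] -->
    u x + l * 0 by apply: cvgD; [exact: cvg_cst | exact: cvgM].
rewrite mulr0 addr0; apply: cvg_trans; apply: near_eq_cvg.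
near=> t.
have t0 : t != 0 by near: t; exact: increments_neq0.
by rewrite /diff_quotient mulfVK// addrC subrK.
Unshelve. all: by end_near. Qed.

Lemma is_partialM u v l m : is_partial u l -> is_partial v m ->
  is_partial (fun y => u y * v y) (l * v x + u x * m).
Proof.
move=> ul vm; rewrite /is_partial.
have -> : diff_quotient phi a (fun y => u y * v y) x =
    (fun t => diff_quotient phi a u x t * v (chart_inv phi (ray t))
              + u x * diff_quotient phi a v x t).
  apply/funext => t; rewrite /diff_quotient; ring.
apply: cvgD; first by apply: cvgM => //; exact: is_partial_along vm.
by apply: cvgM => //; exact: cvg_cst.
Qed.

(** Caratheodory's argument: the slope function of h at u x, completed by the
    derivative at 0, is continuous, and it multiplies the difference quotient
    of u even where the increment of u vanishes. *)
Lemma is_partial_comp (h : R -> R) u d l : is_derive (u x) (1 : R) h d ->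
  is_partial u l -> is_partial (fun y => h (u y)) (d * l).
Proof.
move=> [hd <-] ul.
pose slope s := if s == 0 then 'D_1 h (u x) else (h (u x + s) - h (u x)) / s.
have slope0 : slope 0 = 'D_1 h (u x) by rewrite /slope eqxx.
have slope_cvg : slope s @[s --> (0 : R)] --> 'D_1 h (u x).
  rewrite -slope0; apply/continuous_withinNx; rewrite slope0.
  move: hd; apply: cvg_trans; apply: near_eq_cvg; near=> s.
  have s0 : s != 0 by near: s; exact: nbhs_dnbhs_neq.
  by rewrite /slope (negPf s0) /= /GRing.scale /= mulr1 [s + _]addrC mulrC.
have incr0 : u (chart_inv phi (ray t)) - u x @[t --> increments phi a x]
    --> (0 : R).
  rewrite -(subrr (u x)).
  by apply: cvgB; [exact: is_partial_along ul|exact: cvg_cst].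
rewrite /is_partial.
have -> : diff_quotient phi a (fun y => h (u y)) x =
    (fun t => slope (u (chart_inv phi (ray t)) - u x) *
              diff_quotient phi a u x t).
  apply/funext => t; rewrite /diff_quotient /slope /=; case: eqVneq => [e|ne].
    by rewrite e mul0r mulr0 (subr0_eq e) subrr mul0r.
  by rewrite mulrA mulfVK// [X in _ = (h X - _) / t]addrC subrK.
apply: cvgM => //.
exact: (cvg_comp _ _ incr0 slope_cvg).
Unshelve. all: by end_near. Qed.

End PartialCalculus.

(** * Determinants of positive definite and of row-modified matrices *)

Lemma row_norm_gt0 (R : realType) (n : nat) (v : 'rV[R]_n) :
  v != 0 -> 0 < (v *m v^T) ord0 ord0.
Proof.
move=> v0; rewrite mxE; under eq_bigr do rewrite mxE -expr2.
have ge0 : 0 <= \sum_i v ord0 i ^+ 2 by apply: sumr_ge0 => i _; exact: sqr_ge0.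
rewrite lt_def ge0 andbT; apply: contra v0 => /eqP.
move=> /psumr_eq0P => s0; apply/eqP/rowP => i; rewrite mxE; apply/eqP.
by rewrite -sqrf_eq0 s0// => j _; exact: sqr_ge0.
Qed.

(** The segment from the identity matrix to A consists of matrices B with
    v B v^T > 0 for v <> 0, hence invertible. So the determinant, a polynomial
    along the segment with value 1 at its start, cannot become nonpositive, by
    the intermediate value theorem. *)
Lemma posdef_det_gt0 (R : realType) (n : nat) (A : 'M[R]_n) :
  (forall v : 'rV_n, v != 0 -> 0 < (v *m A *m v^T) ord0 ord0) -> 0 < \det A.
Proof.
move=> Apos; rewrite ltNge; apply/negP => detA.
pose q : {poly R} := \det ('X *: map_mx polyC (A - 1%:M) + 1%:M).
have qE t : q.[t] = \det (t *: A + (1 - t) *: 1%:M).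
  rewrite -horner_evalE -det_map_mx; congr (\det _); apply/matrixP => i j.
  rewrite !mxE /= /horner_eval hornerD hornerM hornerX hornerMn !hornerC.
  by case: (i == j) => /=; ring.
(* - q, because the intermediate value theorem is stated for an increase. *)
have [] := @poly_ivt R (- q) 0 1 ler01.
  rewrite !hornerN !qE oppr_le0 oppr_ge0 scale0r add0r subr0 scale1r det1 ler01.
  by rewrite subrr scale0r addr0 scale1r.
move=> t /andP[t0 t1]; rewrite rootN /root qE => /det0P[v v0 vB].
have : (v *m (t *: A + (1 - t) *: 1%:M) *m v^T) ord0 ord0 = 0.
  by rewrite vB mul0mx mxE.
rewrite mulmxDr mulmxDl -!scalemxAr -!scalemxAl mulmx1 mxE.
rewrite [X in X + _]mxE [X in _ + X]mxE; apply/eqP; rewrite gt_eqF//.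
have vv := row_norm_gt0 v0; have vAv := Apos v v0.
have [->|t1'] := eqVneq t 1; first by rewrite mul1r subrr mul0r addr0.
rewrite ltr_wpDl// ?mulr_ge0 ?(ltW vAv)// mulr_gt0// subr_gt0 lt_neqAle t1'.
by [].
Qed.

Section RowReplacement.
Context {R : realType} {n : nat}.

Definition replace_row (i : 'I_n) (D G : 'M[R]_n) : 'M[R]_n :=
  \matrix_(k, l) if k == i then D k l else G k l.

(** Cofactor expansion along the replaced row: its cofactors are those of G,
    that is det G times the entries of the inverse of G. *)
Lemma det_replace_row i (D G : 'M[R]_n) : G \in unitmx ->
  \det (replace_row i D G) = \det G * \sum_j D i j * invmx G j i.
Proof.
move=> Gu; rewrite (expand_det_row _ i) big_distrr /=.
apply: eq_bigr => j _; rewrite mxE eqxx [RHS]mulrCA; congr (_ * _).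
rewrite /invmx Gu mxE mulrA mulrV ?mul1r; last by rewrite -unitmxE.
rewrite mxE /cofactor; congr (_ * \det _); apply/matrixP => k l.
by rewrite !mxE eq_sym (negPf (neq_lift _ _)).
Qed.

End RowReplacement.

(** * Partial derivatives of determinants and inverse matrices *)

Section MatrixCalculus.
Context {R : realType} {n : nat} {M : topologicalType}.
Variables (phi : chart R n M) (a : 'I_n) (x : M).
Hypothesis phix : chart_dom phi x.

Local Notation is_partial := (is_partial phi a x).

Lemma is_partial_ext u v l m : u =1 v -> l = m ->
  is_partial u l -> is_partial v m.
Proof. by move=> /funext -> ->. Qed.

Lemma is_partialZ (k : R) u l :
  is_partial u l -> is_partial (fun y => k * u y) (k * l).
Proof.
move=> ul.
apply: is_partial_ext (is_partialM (is_partial_cst phi a x k) ul) => //.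
by rewrite mul0r add0r.
Qed.

Lemma is_partialB u v l m : is_partial u l -> is_partial v m ->
  is_partial (fun y => u y - v y) (l - m).
Proof.
move=> ul vm; apply: is_partial_ext (is_partialD ul (is_partialZ (k := -1) vm)).
  by move=> y /=; rewrite mulN1r.
by rewrite mulN1r.
Qed.

Lemma is_partial_sum (I : Type) (s : seq I) (P : pred I) (u : I -> M -> R)
    (l : I -> R) :
  (forall i, is_partial (u i) (l i)) ->
  is_partial (fun y => \sum_(i <- s | P i) u i y) (\sum_(i <- s | P i) l i).
Proof.
move=> ul; elim: s => [|i s IH].
  apply: is_partial_ext (is_partial_cst phi a x 0); last by rewrite big_nil.
  by move=> y; rewrite big_nil.
case Pi : (P i).
  apply: is_partial_ext (is_partialD (ul i) IH); last by rewrite big_cons Pi.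
  by move=> y; rewrite big_cons Pi.
by apply: is_partial_ext IH => [y|]; rewrite big_cons Pi.
Qed.

(** The derivative is a sum of products in which one factor has been replaced
    by its derivative; after the Leibniz formula these become the determinants
    with one replaced row. *)
Lemma is_partial_prod (I : eqType) (s : seq I) (u : I -> M -> R) (l : I -> R) :
  uniq s -> (forall i, is_partial (u i) (l i)) ->
  is_partial (fun y => \prod_(i <- s) u i y)
    (\sum_(i <- s) \prod_(k <- s) if k == i then l k else u k x).
Proof.
move=> + ul; elim: s => [|i s IH] /=.
  move=> _; apply: is_partial_ext (is_partial_cst phi a x 1).
    by move=> y; rewrite big_nil.
  by rewrite big_nil.
move=> /andP[is_ us]; apply: is_partial_ext (is_partialM (ul i) (IH us)).
  by move=> y; rewrite big_cons.
rewrite !big_cons eqxx; congr (_ * _ + _).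
  by apply: eq_big_seq => k ks; case: eqVneq => // ki; rewrite -ki ks in is_.
rewrite big_distrr /=; apply: eq_big_seq => k ks; rewrite big_cons.
by case: eqVneq => // ki; rewrite ki ks in is_.
Qed.

Section Determinant.
Variables (m : nat) (G : M -> 'M[R]_m) (dG : 'M[R]_m).
Hypothesis GdG : forall i j, is_partial (fun y => G y i j) (dG i j).

(** In this form the rule also applies to the minors of an invertible matrix,
    which may be singular; this is how its cofactors are differentiated. *)
Lemma is_partial_det_rows :
  is_partial (fun y => \det (G y)) (\sum_i \det (replace_row i dG (G x))).
Proof.
pose l := \sum_(s : 'S_m) (-1) ^+ s *
  \sum_i \prod_k if k == i then dG k (s k) else G x k (s k).
apply: (is_partial_ext (l := l) (fun=> erefl)).
  rewrite /l; under eq_bigr do rewrite big_distrr /=.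
  rewrite exchange_big /=; apply: eq_bigr => i _; apply: eq_bigr => s _.
  by congr (_ * _); apply: eq_bigr => k _; rewrite mxE.
apply: is_partial_sum => s; apply: is_partialZ.
exact: (is_partial_prod (u := fun k y => G y k (s k)) (index_enum_uniq _)).
Qed.

Hypothesis Gu : G x \in unitmx.

(** Jacobi's formula: [is_partial_det_rows] with each determinant expanded along
    its replaced row. *)
Lemma is_partial_det :
  is_partial (fun y => \det (G y))
    (\det (G x) * \sum_i \sum_j dG i j * invmx (G x) j i).
Proof.
apply: is_partial_ext is_partial_det_rows => //.
by rewrite big_distrr; apply: eq_bigr => i _; exact: det_replace_row.
Qed.

Lemma is_partial_sqrt_det : 0 < \det (G x) ->
  is_partial (fun y => Num.sqrt (\det (G y)))
    (Num.sqrt (\det (G x)) * (2^-1 * \sum_i \sum_j dG i j * invmx (G x) j i)).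
Proof.
move=> dpos.
have := is_partial_comp (u := fun y => \det (G y)) (is_derive1_sqrt dpos)
  is_partial_det.
apply: is_partial_ext => //.
rewrite -{2}(sqr_sqrtr (ltW dpos)); set S := \sum_i _.
have : Num.sqrt (\det (G x)) != 0 by rewrite sqrtr_eq0 -ltNge.
by move: (Num.sqrt _) => v v0; field.
Qed.

End Determinant.

Lemma is_partialV u l : u x != 0 -> is_partial u l ->
  is_partial (fun y => (u y)^-1) (- (u x ^- 2) * l).
Proof.
move=> ux; apply: (@is_partial_comp _ _ _ _ _ _ GRing.inv).
have := @is_deriveV R id (u x) 1 1 ux (is_derive_id _ _).
by rewrite /GRing.scale /= mulr1.
Qed.

Lemma is_partial_div u v l m : v x != 0 -> is_partial u l -> is_partial v m ->
  is_partial (fun y => u y / v y) ((l * v x - u x * m) / v x ^+ 2).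
Proof.
move=> vx ul vm.
apply: is_partial_ext (is_partialM ul (is_partialV vx vm)) => //.
by field.
Qed.

(** The adjugate formula shows that the entries of G^-1 are differentiable;
    their derivatives are then found by differentiating G G^-1 = 1. *)
Lemma is_partial_invmx (W : set M) (G : M -> 'M[R]_n) (dG : 'M[R]_n) :
  open W -> W x -> (forall y, W y -> G y \in unitmx) ->
  (forall i j, is_partial (fun y => G y i j) (dG i j)) ->
  forall i j, is_partial (fun y => invmx (G y) i j)
     (- (invmx (G x) *m (dG *m invmx (G x))) i j).
Proof.
move=> oW Wx Gu GdG.
have [dH HdH] : exists dH : 'M[R]_n,
    forall i j, is_partial (fun y => invmx (G y) i j) (dH i j).
  suff H i j : exists l, is_partial (fun y => invmx (G y) i j) l.
    pose dH i j := projT1 (cid (H i j)).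
    exists (\matrix_(i, j) dH i j) => i j; rewrite mxE.
    exact: (projT2 (cid (H i j))).
  pose minor y := row' j (col' i (G y)).
  have [m minorG] : exists m, is_partial (fun y => \det (minor y)) m.
    exists (\sum_k \det (replace_row k (row' j (col' i dG)) (minor x))).
    apply: is_partial_det_rows => k l.
    apply: (is_partial_ext (u := fun y => G y (lift j k) (lift i l))).
    - by move=> y; rewrite !mxE.
    - by rewrite !mxE.
    - exact: GdG.
  have detG := is_partial_det GdG (Gu x Wx).
  have detG0 : \det (G x) != 0 by rewrite -unitfE -unitmxE; exact: Gu.
  have := is_partialM (is_partialV (u := fun y => \det (G y)) detG0 detG)
     (is_partialZ (k := (-1) ^+ (j + i)) minorG).
  set l := (X in is_partial _ X) => invG; exists l.
  apply: (is_partial_local phix oW Wx _ invG) => y Wy.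
  by rewrite /invmx (Gu y Wy) !mxE.
have dGH : dG *m invmx (G x) + G x *m dH = 0.
  apply/matrixP => i j; rewrite !mxE.
  have GH1 : is_partial (fun y => (G y *m invmx (G y)) i j)
      (\sum_k (dG i k * invmx (G x) k j + G x i k * dH k j)).
    apply: (is_partial_ext (u := fun y => \sum_k G y i k * invmx (G y) k j)).
    - by move=> y; rewrite mxE.
    - by [].
    - by apply: is_partial_sum => k; exact: is_partialM.
  rewrite -big_split -(is_partialE phix GH1) /=; apply: is_partialE => //.
  apply: (is_partial_local phix oW Wx _ (is_partial_cst phi a x ((i == j)%:R))).
  by move=> y Wy /=; rewrite mulmxV ?mxE//; exact: Gu.
move=> i j; apply: is_partial_ext (HdH i j) => //.
have : invmx (G x) *m (dG *m invmx (G x) + G x *m dH) = 0 by rewrite dGH mulmx0.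
rewrite mulmxDr mulmxA (mulmxA _ (G x)) mulVmx ?Gu// mul1mx addrC => /eqP.
by rewrite addr_eq0 => /eqP ->; rewrite mxE.
Qed.

End MatrixCalculus.

(** * Hoelder classes *)

Section HolderClasses.
Context {R : realType} {n : nat} {M : topologicalType}.
Variables (phi : chart R n M) (W : set M).
Hypotheses (oW : open W) (Wphi : W `<=` chart_dom phi).
Implicit Types (u v : M -> R) (alpha : R).

(** The iterated partial derivatives on an open set see only values on it. *)
Lemma holder_class_ext k alpha u v : (forall y, W y -> u y = v y) ->
  holder_class phi W k alpha u -> holder_class phi W k alpha v.
Proof.
elim: k u v => [|k IH] u v uv /= [cu Hu]; (split; first
  by apply: (subspace_eq_continuous _ cu) => y; rewrite inE; exact: uv).
  move=> x Wx; have [V xV [C HC]] := Hu x Wx; exists V => //; exists C => y z *.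
  by rewrite -!uv//; exact: HC.
move=> a; have [ex Hp] := Hu a; split=> [x Wx|].
  exact/is_partial_ex/(is_partial_local (Wphi Wx) oW Wx uv)/has_partialP/ex.
apply: (IH (partial phi a u)) => // x Wx.
apply/esym/is_partialE; first exact: Wphi.
exact/(is_partial_local (Wphi Wx) oW Wx uv)/has_partialP/ex.
Qed.

(** For exponent 0 the Hoelder condition is local boundedness. *)
Lemma locally_holder0 u : {within W, continuous u} -> locally_holder phi W 0 u.
Proof.
move=> cu x Wx.
have ux : nbhs (u x) [set s | `|s - u x| < 1].
  have := nbhsx_ballx (u x) 1 ltr01; apply: filterS => s /=.
  by rewrite /ball /= distrC.
exists [set y | W y -> `|u y - u x| < 1].
  have : nbhs (x : subspace W) [set y | `|u y - u x| < 1] by exact: (cu x _ ux).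
  by rewrite -[nbhs _]nbhs_subspace_in.
exists 2 => y z Vy Wy Vz Wz; rewrite powRr0 mulr1.
have := Vy Wy; have := Vz Wz => zx yx.
rewrite -(subrKA (u x)) (le_trans (ler_normD _ _))// (distrC (u x)).
by have := lerD (ltW yx) (ltW zx).
Qed.

Lemma holder_class0 k alpha u :
  holder_class phi W k alpha u -> holder_class phi W k 0 u.
Proof.
elim: k u => [|k IH] u /= [cu Hu]; split=> //; first exact: locally_holder0.
by move=> a; have [? ?] := Hu a; split=> //; exact: IH.
Qed.

Lemma holder_classW k u :
  holder_class phi W k.+1 0 u -> holder_class phi W k 0 u.
Proof.
elim: k u => [|k IH] u /= [cu Hu]; split=> //; first exact: locally_holder0.
by move=> a; have [? ?] := Hu a; split=> //; exact: IH.
Qed.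

Lemma holder_class_le j k alpha u : (j <= k)%N ->
  holder_class phi W k alpha u -> holder_class phi W j 0 u.
Proof.
move=> /subnK <- /holder_class0; elim: (k - j)%N => // i IH.
by rewrite addSn => /holder_classW.
Qed.

Lemma holder_classD k u v : holder_class phi W k 0 u ->
  holder_class phi W k 0 v -> holder_class phi W k 0 (fun y => u y + v y).
Proof.
elim: k u v => [|k IH] u v [cu Hu] [cv Hv].
  have cuv : {within W, continuous (fun y => u y + v y)}.
    by move=> y; apply: cvgD; [exact: cu|exact: cv].
  by split=> //; exact: locally_holder0.
split; first by move=> y; apply: cvgD; [exact: cu|exact: cv].
move=> a; have [exu Hpu] := Hu a; have [exv Hpv] := Hv a.
have uv x (Wx : W x) :=
  is_partialD (has_partialP (exu x Wx)) (has_partialP (exv x Wx)).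
split=> [x Wx|]; first exact: is_partial_ex (uv x Wx).
apply: holder_class_ext (IH _ _ Hpu Hpv) => x Wx.
by apply/esym/is_partialE; [exact: Wphi|exact: uv].
Qed.

Lemma holder_classM k u v : holder_class phi W k 0 u ->
  holder_class phi W k 0 v -> holder_class phi W k 0 (fun y => u y * v y).
Proof.
elim: k u v => [|k IH] u v Hu Hv; have [cu Hu'] := Hu; have [cv Hv'] := Hv.
  have cuv : {within W, continuous (fun y => u y * v y)}.
    by move=> y; apply: cvgM; [exact: cu|exact: cv].
  by split=> //; exact: locally_holder0.
split; first by move=> y; apply: cvgM; [exact: cu|exact: cv].
move=> a; have [exu Hpu] := Hu' a; have [exv Hpv] := Hv' a.
have uv x (Wx : W x) :=
  is_partialM (has_partialP (exu x Wx)) (has_partialP (exv x Wx)).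
split=> [x Wx|]; first exact: is_partial_ex (uv x Wx).
have := holder_classD (IH _ _ Hpu (holder_classW Hv))
  (IH _ _ (holder_classW Hu) Hpv).
apply: holder_class_ext => x Wx.
by apply/esym/is_partialE; [exact: Wphi|exact: uv].
Qed.

(** The part of C^2 regularity that pointwise identities between second
    derivatives use: every expression in them can be differentiated. *)
Definition twice_partial u : Prop := forall x, W x ->
  forall a, has_partial phi a u x /\
  forall b, has_partial phi b (partial phi a u) x.

Lemma holder_class_twice_partial k alpha u : (2 <= k)%N ->
  holder_class phi W k alpha u -> twice_partial u.
Proof.
move=> k2 /(holder_class_le k2) /= [_ Hu] x Wx a; have [exu [_ Hpu]] := Hu a.
by split=> [|b]; [exact: exu | have [+ _] := Hpu b; exact].
Qed.

Lemma twice_partialM u v : twice_partial u -> twice_partial v ->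
  twice_partial (fun y => u y * v y).
Proof.
move=> u2 v2.
have uv y a (Wy : W y) := is_partialM (has_partialP (u2 y Wy a).1)
  (has_partialP (v2 y Wy a).1).
move=> y Wy a; split=> [|b]; first exact: is_partial_ex (uv y a Wy).
apply: is_partial_ex; apply: (is_partial_local (Wphi Wy) oW Wy).
  by move=> z Wz; rewrite (is_partialE (Wphi Wz) (uv z a Wz)).
apply: is_partialD.
  apply: is_partialM; apply: has_partialP.
    exact: (u2 y Wy a).2.
  exact: (v2 y Wy b).1.
apply: is_partialM; apply: has_partialP.
  exact: (u2 y Wy b).1.
exact: (v2 y Wy a).2.
Qed.

End HolderClasses.

(** * The algebra of the conformal change of scalar curvature *)

Section ConformalCurvatureAlgebra.
Context {R : realFieldType} {n : nat}.
Implicit Types (a b c d e : 'I_n).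

Lemma sum_deltal (F : 'I_n -> R) c : \sum_a (c == a)%:R * F a = F c.
Proof.
rewrite (bigD1 c)//= eqxx mul1r big1 ?addr0// => a ac.
by rewrite eq_sym (negPf ac) mul0r.
Qed.

Lemma sum_deltar (F : 'I_n -> R) c : \sum_a (a == c)%:R * F a = F c.
Proof. by rewrite -[RHS]sum_deltal; apply: eq_bigr => a _; rewrite eq_sym. Qed.

(* Values at one point: G and H stand for g_ab and g^ab, dG a b c and dH a b c
   for the derivatives d_a g_bc and d_a g^bc, and later w a and dw a b for a
   covector w_a and its derivatives d_a w_b. *)
Variables (G H : 'I_n -> 'I_n -> R) (dG dH : 'I_n -> 'I_n -> 'I_n -> R).
Hypothesis Gsym : forall a b, G a b = G b a.
Hypothesis Hsym : forall a b, H a b = H b a.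
Hypothesis GH : forall a b, \sum_c G a c * H c b = (a == b)%:R.
Hypothesis dGsym : forall a b c, dG a b c = dG a c b.
Hypothesis dHE : forall a b c,
  dH a b c = - \sum_d H b d * \sum_e dG a d e * H e c.

Definition gamma c a b : R :=
  2^-1 * \sum_d H c d * (dG a b d + dG b a d - dG d a b).

(** The logarithmic derivative of |g|^(1/2), by Jacobi's formula. *)
Definition half_trace a : R := 2^-1 * \sum_b \sum_c dG a b c * H c b.

Definition metric_trace (X : 'I_n -> 'I_n -> 'I_n -> R) e : R :=
  \sum_c \sum_b H c b * X e b c.

Lemma HG a b : \sum_c H a c * G c b = (a == b)%:R.
Proof.
rewrite eq_sym -GH; apply: eq_bigr => c _.
by rewrite (Gsym c b) (Hsym a c) mulrC.
Qed.

Lemma HG_trace : \sum_c \sum_b H c b * G b c = n%:R.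
Proof.
under eq_bigr do rewrite HG eqxx.
by rewrite sumr_const card_ord.
Qed.

Lemma gamma_sym c a b : gamma c a b = gamma c b a.
Proof.
rewrite /gamma; congr (_ * _); apply: eq_bigr => d _.
by rewrite (dGsym d a b); ring.
Qed.

(** In the trace over the upper and first lower index, two of the three
    derivatives of the metric cancel by symmetry of g^ab. *)
Lemma gamma_trace e : \sum_a gamma a a e = half_trace e.
Proof.
rewrite /gamma /half_trace -big_distrr /=; congr (_ * _).
have swap : \sum_a \sum_d H a d * dG a e d = \sum_a \sum_d H a d * dG d a e.
  rewrite exchange_big; apply: eq_bigr => a _; apply: eq_bigr => d _.
  by rewrite Hsym dGsym.
transitivity (\sum_a \sum_d H a d * dG a e d + \sum_a \sum_d H a d * dG e a d
              - \sum_a \sum_d H a d * dG d a e).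
  rewrite -big_split -sumrB; apply: eq_bigr => a _.
  by rewrite -big_split -sumrB; apply: eq_bigr => d _ /=; ring.
rewrite swap addrAC subrr add0r; apply: eq_bigr => a _; apply: eq_bigr => d _.
by rewrite Hsym mulrC.
Qed.

Variables (w : 'I_n -> R) (dw : 'I_n -> 'I_n -> R).

Definition raise c : R := \sum_d H c d * w d.

(** The derivative d_a w^c of [raise], by the product rule. *)
Definition draise a c : R := \sum_d (dH a c d * w d + H c d * dw a d).

(** How the Christoffel symbols change when the metric is multiplied by c,
    with w_a = d_a c / (2 c). *)
Definition conn_shift c a b : R :=
  (c == a)%:R * w b + (c == b)%:R * w a - G a b * raise c.

(** The derivative d_e of [conn_shift], by the product rule. *)
Definition dconn_shift e c a b : R :=
  (c == a)%:R * dw e b + (c == b)%:R * dw e a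
  - (dG e a b * raise c + G a b * draise e c).

Definition norm2 : R := \sum_e w e * raise e.

Lemma lower_raise c : \sum_a G c a * raise a = w c.
Proof.
rewrite /raise; under eq_bigr do rewrite big_distrr /=.
rewrite exchange_big /= -[RHS]sum_deltal; apply: eq_bigr => d _.
by rewrite -GH big_distrl /=; apply: eq_bigr => a _; rewrite mulrA.
Qed.

(** Both sides are the derivative d_b of g_ca w^a = w_c. *)
Lemma lower_draise b c :
  \sum_a (dG b c a * raise a + G c a * draise b a) = dw b c.
Proof.
have GdH d : \sum_a G c a * dH b a d = - \sum_a dG b c a * H a d.
  under eq_bigr => a _ do rewrite dHE mulrN big_distrr /=.
  rewrite sumrN; congr (- _); rewrite exchange_big /=.
  rewrite -[RHS](sum_deltal (fun k => \sum_a dG b k a * H a d)).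
  apply: eq_bigr => k _; rewrite -GH big_distrl.
  by apply: eq_bigr => a _; rewrite mulrA.
rewrite -[RHS](sum_deltal (dw b)) big_split /=.
transitivity (\sum_d ((\sum_a dG b c a * H a d) * w d
    + ((\sum_a G c a * dH b a d) * w d + (c == d)%:R * dw b d))); last first.
  by apply: eq_bigr => d _; rewrite GdH mulNr addrA subrr add0r.
rewrite big_split /=; congr (_ + _).
  rewrite /raise; under eq_bigr do rewrite big_distrr /=.
  rewrite exchange_big /=; apply: eq_bigr => d _.
  by rewrite big_distrl /=; apply: eq_bigr => a _; rewrite mulrA.
rewrite /draise; under eq_bigr do rewrite big_distrr /=.
rewrite exchange_big /=; apply: eq_bigr => d _.
rewrite -GH !big_distrl -big_split /=; apply: eq_bigr => a _; ring.
Qed.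

Lemma shift_sym c a b : conn_shift c a b = conn_shift c b a.
Proof. by rewrite /conn_shift (Gsym a b) [X in X - _]addrC. Qed.

Lemma shift_trace c : \sum_a conn_shift a a c = n%:R * w c.
Proof.
rewrite /conn_shift sumrB big_split /= sum_deltar.
under [X in X + _ - _]eq_bigr do rewrite eqxx mul1r.
under [X in _ - X]eq_bigr do rewrite Gsym.
by rewrite lower_raise addrK sumr_const card_ord mulr_natl.
Qed.

Lemma metric_trace_shift e : metric_trace conn_shift e = (2 - n%:R) * raise e.
Proof.
transitivity (\sum_c \sum_b (e == b)%:R * (H c b * w c)
   + \sum_c (e == c)%:R * (\sum_b H c b * w b)
   - (\sum_c \sum_b H c b * G b c) * raise e).
  rewrite /metric_trace big_distrl -big_split -sumrB; apply: eq_bigr => c _ /=.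
  rewrite big_distrl big_distrr -big_split -sumrB; apply: eq_bigr => b _ /=.
  by rewrite /conn_shift; ring.
under eq_bigr do rewrite sum_deltal.
rewrite sum_deltal HG_trace -/(raise e).
under eq_bigr do rewrite Hsym.
by rewrite -/(raise e); ring.
Qed.

(** Of the three terms of [conn_shift], the first gives the right-hand side; the
    two others are w^c X^a_ac and - w^a X^c_ac, which cancel because X is
    symmetric in its lower indices. *)
Lemma cross_shift (X : 'I_n -> 'I_n -> 'I_n -> R) :
  (forall c a b, X c a b = X c b a) ->
  \sum_c \sum_b H c b * \sum_a \sum_e conn_shift a b e * X e a c
  = \sum_e w e * metric_trace X e.
Proof.
move=> Xsym.
transitivity (\sum_c \sum_b \sum_a \sum_e
    ((a == b)%:R * (H c b * (w e * X e a c)) +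
     (a == e)%:R * (H c b * w b * X e a c) -
     H c b * G b e * (raise a * X e a c))).
  apply: eq_bigr => c _; apply: eq_bigr => b _; rewrite big_distrr /=.
  apply: eq_bigr => a _; rewrite big_distrr /=; apply: eq_bigr => e _.
  by rewrite /conn_shift; ring.
have -> : \sum_e w e * metric_trace X e =
    \sum_c \sum_b \sum_e H c b * (w e * X e b c).
  under eq_bigr do rewrite /metric_trace big_distrr /=.
  rewrite exchange_big; apply: eq_bigr => c _ /=.
  under eq_bigr do rewrite big_distrr /=.
  rewrite exchange_big; apply: eq_bigr => b _ /=; apply: eq_bigr => e _; ring.
transitivity (\sum_c (\sum_b \sum_e H c b * (w e * X e b c)
    + raise c * (\sum_a X a a c) - \sum_a raise a * X c a c)).
  apply: eq_bigr => c _.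
  have -> : \sum_b \sum_e H c b * (w e * X e b c) =
     \sum_b \sum_a \sum_e (a == b)%:R * (H c b * (w e * X e a c)).
    apply: eq_bigr => b _; rewrite exchange_big; apply: eq_bigr => e _ /=.
    by rewrite sum_deltar.
  have -> : raise c * (\sum_a X a a c) =
     \sum_b \sum_a \sum_e (a == e)%:R * (H c b * w b * X e a c).
    rewrite /raise big_distrl; apply: eq_bigr => b _ /=.
    by rewrite big_distrr; apply: eq_bigr => a _ /=; rewrite sum_deltal.
  have -> : \sum_a raise a * X c a c =
     \sum_b \sum_a \sum_e H c b * G b e * (raise a * X e a c).
    rewrite exchange_big; apply: eq_bigr => a _ /=; rewrite exchange_big /=.
    rewrite -(sum_deltal (fun e => raise a * X e a c)); apply: eq_bigr => e _.
    by rewrite -HG big_distrl.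
  rewrite -big_split -sumrB; apply: eq_bigr => b _ /=.
  rewrite -big_split -sumrB; apply: eq_bigr => a _ /=.
  by rewrite -big_split -sumrB.
rewrite sumrB big_split /= -[LHS]addrA -[RHS]addr0; congr (_ + _).
rewrite [X in _ - X]exchange_big; apply/eqP; rewrite subr_eq0; apply/eqP.
apply: eq_bigr => c _ /=; rewrite big_distrr; apply: eq_bigr => a _ /=.
by rewrite Xsym.
Qed.

(** By symmetry of g^bc two of the three derivatives in gamma have the same
    trace; the third gives a logarithmic derivative of |g|^(1/2). *)
Lemma metric_trace_gamma e : metric_trace gamma e =
  \sum_d H e d * (\sum_a \sum_b H a b * dG a b d - half_trace d).
Proof.
transitivity (\sum_c \sum_b \sum_d H e d * (2^-1 * (H c b * dG c b d)
    + 2^-1 * (H c b * dG b c d) - 2^-1 * (dG d b c * H c b))).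
  apply: eq_bigr => c _; apply: eq_bigr => b _; rewrite /gamma !big_distrr /=.
  by apply: eq_bigr => d _; ring.
under eq_bigr do rewrite exchange_big /=.
rewrite exchange_big; apply: eq_bigr => d _ /=.
under eq_bigr do rewrite -big_distrr /=.
rewrite -big_distrr; congr (_ * _) => /=.
under eq_bigr do rewrite sumrB big_split /= -!big_distrr /=.
rewrite sumrB big_split /= -!big_distrr /=.
have -> : \sum_c \sum_b H c b * dG b c d = \sum_c \sum_b H c b * dG c b d.
  rewrite exchange_big; apply: eq_bigr => c _; apply: eq_bigr => b _ /=.
  by rewrite Hsym.
rewrite /half_trace [X in _ - 2^-1 * X]exchange_big /=.
by field.
Qed.

(** The derivatives d_a g^ad contained in d_a w^a are, by dH = - H dG H, the sum
    of - g^bc Gamma^d_bc and - g^de d_e log |g|^(1/2). *)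
Lemma div_raise : \sum_c \sum_b H c b * dw b c =
  \sum_a draise a a + \sum_e w e * metric_trace gamma e
  + \sum_e half_trace e * raise e.
Proof.
pose P d := \sum_a \sum_b H a b * dG a b d.
have -> : \sum_a draise a a =
    - (\sum_d P d * raise d) + \sum_c \sum_b H c b * dw b c.
  rewrite /draise; under eq_bigr do rewrite big_split /=.
  rewrite big_split /= [X in _ = _ + X]exchange_big /=.
  congr (_ + _); last first.
    by apply: eq_bigr => a _; apply: eq_bigr => d _; rewrite Hsym.
  transitivity (- \sum_a \sum_d \sum_b \sum_e H a b * dG a b e * (H e d * w d)).
    rewrite -sumrN; apply: eq_bigr => a _.
    rewrite -sumrN; apply: eq_bigr => d _.
    rewrite dHE mulNr big_distrl; congr (- _); apply: eq_bigr => b _ /=.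
    by rewrite big_distrr big_distrl; apply: eq_bigr => e _ /=; ring.
  congr (- _); rewrite /P.
  transitivity (\sum_a \sum_b \sum_e H a b * dG a b e * raise e).
    apply: eq_bigr => a _; rewrite exchange_big; apply: eq_bigr => b _ /=.
    by rewrite exchange_big; apply: eq_bigr => e _ /=; rewrite -big_distrr.
  under [RHS]eq_bigr do rewrite big_distrl /=.
  rewrite [RHS]exchange_big /=; apply: eq_bigr => a _.
  by rewrite exchange_big; apply: eq_bigr => d _ /=; rewrite big_distrl.
under [X in _ + X + _]eq_bigr do rewrite metric_trace_gamma big_distrr /=.
rewrite [X in _ + X + _]exchange_big /=.
have -> : \sum_d \sum_e w e * (H e d * (P d - half_trace d)) =
    \sum_d P d * raise d - \sum_d half_trace d * raise d.
  rewrite -sumrB; apply: eq_bigr => d _; rewrite -mulrBl /raise big_distrr /=.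
  by apply: eq_bigr => e _; rewrite Hsym; ring.
by ring.
Qed.

Lemma quad_trace (X Y : 'I_n -> 'I_n -> 'I_n -> R) :
  \sum_c \sum_b H c b * \sum_a \sum_e X a a e * Y e b c
  = \sum_e (\sum_a X a a e) * metric_trace Y e.
Proof.
transitivity (\sum_c \sum_b \sum_e (\sum_a X a a e) * (H c b * Y e b c)).
  apply: eq_bigr => c _; apply: eq_bigr => b _.
  rewrite exchange_big big_distrr; apply: eq_bigr => e _ /=.
  by rewrite -big_distrl /=; ring.
under eq_bigr do rewrite exchange_big /=.
rewrite exchange_big; apply: eq_bigr => e _ /=.
under eq_bigr do rewrite -big_distrr /=.
by rewrite -big_distrr.
Qed.

(** Exchanging the two pairs of summation indices. *)
Lemma cross_swap (X Y : 'I_n -> 'I_n -> 'I_n -> R) :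
  (forall c a b, X c a b = X c b a) -> (forall c a b, Y c a b = Y c b a) ->
  \sum_c \sum_b H c b * (\sum_a \sum_e X a b e * Y e a c)
  = \sum_c \sum_b H c b * (\sum_a \sum_e Y a b e * X e a c).
Proof.
move=> Xsym Ysym; rewrite exchange_big; apply: eq_bigr => c _.
apply: eq_bigr => b _ /=; rewrite Hsym exchange_big; congr (_ * _).
apply: eq_bigr => a _; apply: eq_bigr => e _ /=.
by rewrite Xsym Ysym mulrC.
Qed.

(** The trace of the change of the curvature tensor when gamma becomes
    gamma + conn_shift. Expanding the products gives three terms with
    contracted first factors ([quad_trace]) and three with crossed indices
    ([cross_swap], [cross_shift]); what remains is a multiple of |w|^2 and,
    through [div_raise], of the divergence d_a w^a + w^a d_a log |g|^(1/2). *)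
Lemma conformal_curvature_trace :
  \sum_c \sum_b H c b * \sum_a (dconn_shift a a b c - dconn_shift b a a c
    + \sum_e
       ((gamma a a e + conn_shift a a e) * (gamma e b c + conn_shift e b c)
      - (gamma a b e + conn_shift a b e) * (gamma e a c + conn_shift e a c)
      - (gamma a a e * gamma e b c - gamma a b e * gamma e a c)))
  = - 2 * (n%:R - 1) * (\sum_a draise a a + \sum_a half_trace a * raise a)
    - (n%:R - 1) * (n%:R - 2) * norm2.
Proof.
pose quad (X Y : 'I_n -> 'I_n -> 'I_n -> R) :=
  \sum_c \sum_b H c b * \sum_a \sum_e X a a e * Y e b c.
pose cross (X Y : 'I_n -> 'I_n -> 'I_n -> R) :=
  \sum_c \sum_b H c b * \sum_a \sum_e X a b e * Y e a c.
transitivity (\sum_c \sum_b H c b * \sum_a dconn_shift a a b c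
    - \sum_c \sum_b H c b * \sum_a dconn_shift b a a c
    + (quad gamma conn_shift + quad conn_shift gamma
       + quad conn_shift conn_shift)
    - (cross gamma conn_shift + cross conn_shift gamma
       + cross conn_shift conn_shift)).
  rewrite /quad /cross -!big_split -!sumrB -!big_split -sumrB /=.
  apply: eq_bigr => c _.
  rewrite -!big_split -!sumrB -!big_split -sumrB /=; apply: eq_bigr => b _.
  rewrite -!mulrDr -!mulrBr -!mulrDr -mulrBr; congr (_ * _).
  rewrite -!big_split -!sumrB -!big_split -sumrB /=; apply: eq_bigr => a _.
  rewrite -[RHS]addrA; congr (_ + _).
  rewrite -!big_split -!sumrB /=; apply: eq_bigr => e _; ring.
have gs := gamma_sym; have ss := shift_sym.
have crossgs : cross gamma conn_shift = cross conn_shift gamma.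
  exact: cross_swap.
rewrite crossgs /cross !cross_shift// /quad !quad_trace.
have Qsym : \sum_c \sum_b H c b * dw c b = \sum_c \sum_b H c b * dw b c.
  rewrite exchange_big; apply: eq_bigr => c _; apply: eq_bigr => b _ /=.
  by rewrite Hsym.
have -> : \sum_c \sum_b H c b * \sum_a dconn_shift b a a c =
    n%:R * \sum_c \sum_b H c b * dw b c.
  rewrite big_distrr; apply: eq_bigr => c _; rewrite big_distrr.
  apply: eq_bigr => b _ /=; rewrite mulrCA; congr (_ * _).
  rewrite /dconn_shift sumrB big_split /= sum_deltar.
  under [X in X + _ - _]eq_bigr do rewrite eqxx mul1r.
  under [X in _ - X]eq_bigr do rewrite dGsym Gsym.
  by rewrite lower_draise addrK sumr_const card_ord mulr_natl.
have -> : \sum_c \sum_b H c b * \sum_a dconn_shift a a b c =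
    2 * (\sum_c \sum_b H c b * dw b c) - 2 * (\sum_a half_trace a * raise a)
    - n%:R * \sum_a draise a a.
  have Hdshift c b : \sum_a dconn_shift a a b c =
      dw b c + dw c b - (\sum_a dG a b c * raise a) - G b c * \sum_a draise a a.
    rewrite /dconn_shift sumrB !big_split /= !sum_deltar big_distrr /=; ring.
  under eq_bigr => c _ do under eq_bigr => b _ do rewrite Hdshift.
  have -> : 2 * (\sum_a half_trace a * raise a) =
     \sum_c \sum_b H c b * \sum_a dG a b c * raise a.
    rewrite /half_trace big_distrr /=.
    under eq_bigr do rewrite mulrA mulrA divff ?pnatr_eq0// mul1r big_distrl /=.
    rewrite exchange_big [RHS]exchange_big; apply: eq_bigr => b _ /=.
    under eq_bigr do rewrite big_distrl /=.
    rewrite exchange_big; apply: eq_bigr => c _ /=; rewrite big_distrr.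
    by apply: eq_bigr => a _ /=; ring.
  rewrite -HG_trace big_distrl /= mulr2n mulrDl mul1r -{2}Qsym.
  rewrite -big_split -!sumrB; apply: eq_bigr => c _ /=.
  rewrite big_distrl -big_split -!sumrB; apply: eq_bigr => b _ /=; ring.
have -> : \sum_e (\sum_a gamma a a e) * metric_trace conn_shift e =
    (2 - n%:R) * \sum_e half_trace e * raise e.
  rewrite big_distrr; apply: eq_bigr => e _ /=.
  by rewrite gamma_trace metric_trace_shift mulrCA.
have -> : \sum_e (\sum_a conn_shift a a e) * metric_trace gamma e =
    n%:R * \sum_e w e * metric_trace gamma e.
  rewrite big_distrr; apply: eq_bigr => e _ /=.
  by rewrite shift_trace mulrA.
have -> : \sum_e (\sum_a conn_shift a a e) * metric_trace conn_shift e =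
    n%:R * (2 - n%:R) * norm2.
  rewrite big_distrr; apply: eq_bigr => e _ /=.
  by rewrite shift_trace metric_trace_shift; ring.
have -> : \sum_e w e * metric_trace conn_shift e = (2 - n%:R) * norm2.
  rewrite big_distrr; apply: eq_bigr => e _ /=.
  by rewrite metric_trace_shift; ring.
rewrite div_raise.
by ring.
Qed.

End ConformalCurvatureAlgebra.

(** * Conformal change of the curvature and of the Laplacian in one chart *)

Section ChartGeometry.
Context {R : realType} {n : nat} {M : topologicalType}.
Variables (phi : chart R n M) (W : set M) (g : tensor2 R n M).
Hypotheses (oW : open W) (Wphi : W `<=` chart_dom phi).
Hypothesis gsym : forall y, W y -> (g phi y)^T = g phi y.
Hypothesis gdet : forall y, W y -> 0 < \det (g phi y).
Hypothesis g2 : forall b c, twice_partial phi W (fun y => g phi y b c).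
Implicit Types (a b c d e : 'I_n) (u v f : M -> R).

Definition lower_metric (y : M) a b : R := g phi y a b.
Definition upper_metric (y : M) a b : R := ginv g phi a b y.
Definition dlower_metric (y : M) a b c : R :=
  partial phi a (fun z => g phi z b c) y.
Definition dupper_metric (y : M) a b c : R :=
  partial phi a (fun z => ginv g phi b c z) y.

Local Notation G := lower_metric.
Local Notation H := upper_metric.
Local Notation dg := dlower_metric.
Local Notation dH := dupper_metric.

Lemma metric_unit y : W y -> g phi y \in unitmx.
Proof. by move=> Wy; rewrite unitmxE unitfE gt_eqF// gdet. Qed.

Lemma is_partial_metric y a b c : W y ->
  is_partial phi a y (fun z => g phi z b c) (dg y a b c).
Proof. by move=> Wy; apply: has_partialP; have [] := g2 b c Wy a. Qed.

Lemma metric_sym y a b : W y -> G y a b = G y b a.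
Proof. by move=> Wy; rewrite /lower_metric -{1}gsym// mxE. Qed.

Lemma ginv_sym y a b : W y -> H y a b = H y b a.
Proof. by move=> Wy; rewrite /upper_metric /ginv -{1}gsym// -trmx_inv mxE. Qed.

Lemma metric_ginv y a b : W y -> \sum_c G y a c * H y c b = (a == b)%:R.
Proof.
move=> Wy; have /matrixP/(_ a b) := mulmxV (metric_unit Wy).
by rewrite !mxE.
Qed.

Lemma dmetric_sym y a b c : W y -> dg y a b c = dg y a c b.
Proof.
move=> Wy; apply: is_partialE; first exact: Wphi.
apply: (is_partial_local (Wphi Wy) oW Wy _ (@is_partial_metric _ a c b Wy)).
move=> z Wz.
exact: metric_sym.
Qed.

Lemma is_partial_ginv_explicit y a b c : W y ->
  is_partial phi a y (fun z => ginv g phi b c z)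
    (- \sum_d H y b d * \sum_e dg y a d e * H y e c).
Proof.
move=> Wy; pose D : 'M[R]_n := \matrix_(i, j) dg y a i j.
have DE i j : is_partial phi a y (fun z => g phi z i j) (D i j).
  by rewrite mxE; exact: is_partial_metric.
have := is_partial_invmx (Wphi Wy) oW Wy metric_unit DE (i := b) (j := c).
apply: is_partial_ext => //; rewrite !mxE; congr (- _); apply: eq_bigr => d _.
by rewrite mxE; congr (_ * _); apply: eq_bigr => e _; rewrite mxE.
Qed.

Lemma dginvE y a b c : W y ->
  dH y a b c = - \sum_d H y b d * \sum_e dg y a d e * H y e c.
Proof.
move=> Wy; apply: is_partialE (@is_partial_ginv_explicit _ _ _ _ Wy).
exact: Wphi.
Qed.

Lemma is_partial_ginv y a b c : W y ->
  is_partial phi a y (fun z => ginv g phi b c z) (dH y a b c).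
Proof. by move=> Wy; rewrite dginvE//; exact: is_partial_ginv_explicit. Qed.

Lemma vol_gt0 y : W y -> 0 < vol g phi y.
Proof. by move=> Wy; rewrite /vol sqrtr_gt0 gdet. Qed.

Lemma is_partial_vol y a : W y ->
  is_partial phi a y (vol g phi) (vol g phi y * half_trace (H y) (dg y) a).
Proof.
move=> Wy; pose D : 'M[R]_n := \matrix_(i, j) dg y a i j.
have DE i j : is_partial phi a y (fun z => g phi z i j) (D i j).
  by rewrite mxE; exact: is_partial_metric.
have := is_partial_sqrt_det DE (metric_unit Wy) (gdet Wy).
apply: is_partial_ext => //; congr (_ * (_ * _)).
by apply: eq_bigr => b _; apply: eq_bigr => c _; rewrite mxE.
Qed.

Lemma christoffelE c a b y :
  christoffel g phi c a b y = gamma (H y) (dg y) c a b.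
Proof. by []. Qed.

Lemma is_partial_christoffel y e c a b : W y ->
  is_partial phi e y (christoffel g phi c a b)
    (partial phi e (christoffel g phi c a b) y).
Proof.
move=> Wy; apply: has_partialP; apply: is_partial_ex.
have ddg i j k := has_partialP ((g2 j k Wy i).2 e).
rewrite /christoffel; apply: is_partialZ; apply: is_partial_sum => d.
apply: is_partialM; first exact: is_partial_ginv.
by apply: is_partialB; [apply: is_partialD|]; exact: ddg.
Qed.

(** The vector density |g|^(1/2) g^ab d_b u, whose divergence is - |g|^(1/2)
    times the Laplacian. *)
Definition flux u a (y : M) : R :=
  vol g phi y * \sum_b ginv g phi a b y * partial phi b u y.

Lemma is_partial_flux u a y : twice_partial phi W u -> W y ->
  is_partial phi a y (flux u a) (partial phi a (flux u a) y).
Proof.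
move=> u2 Wy; apply: has_partialP; apply: is_partial_ex.
apply: is_partialM; first exact: is_partial_vol.
apply: is_partial_sum => b; apply: is_partialM; first exact: is_partial_ginv.
exact/has_partialP/((u2 y Wy b).2 a).
Qed.

Lemma laplacianE u y :
  laplacian g phi u y
  = - ((vol g phi y)^-1 * \sum_a partial phi a (flux u a) y).
Proof. by []. Qed.

Lemma partial_local a u v y : (forall z, W z -> u z = v z) -> W y ->
  has_partial phi a u y -> partial phi a v y = partial phi a u y.
Proof.
move=> uv Wy /has_partialP uy; apply: is_partialE; first exact: Wphi.
exact: (is_partial_local (Wphi Wy) oW Wy uv).
Qed.

Lemma laplacian_local u v y : twice_partial phi W u ->
  (forall z, W z -> u z = v z) -> W y ->
  laplacian g phi v y = laplacian g phi u y.
Proof.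
move=> u2 uv Wy; rewrite !laplacianE; congr (- (_ * _)).
apply: eq_bigr => a _; apply: partial_local => //.
  move=> z Wz; congr (_ * _); apply: eq_bigr => b _; congr (_ * _).
  by apply/esym/partial_local => //; have [] := u2 z Wz b.
exact: is_partial_ex (is_partial_flux u2 Wy).
Qed.

Section ConformalChange.
Variables (f : M -> R) (q : R).
Hypothesis fpos : forall y, W y -> 0 < f y.
Hypothesis f2 : twice_partial phi W f.

Local Notation factor y := (f y `^ q).
Local Notation gt := (conformal_metric (fun y => f y `^ q) g).

(** Half the gradient of log (f^q), written without the logarithm. *)
Definition log_slope (y : M) a : R := q / 2 * (partial phi a f y / f y).
Definition dlog_slope (y : M) e a : R :=
  partial phi e (fun z => log_slope z a) y.

Local Notation w := log_slope.
Local Notation dw := dlog_slope.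

Lemma is_partial_f y a : W y -> is_partial phi a y f (partial phi a f y).
Proof. by move=> Wy; apply: has_partialP; have [] := f2 Wy a. Qed.

Lemma is_partial_log_slope y e a : W y ->
  is_partial phi e y (fun z => w z a) (dw y e a).
Proof.
move=> Wy; apply: has_partialP; apply: is_partial_ex; apply: is_partialZ.
apply: is_partial_div; last exact: is_partial_f.
  by rewrite gt_eqF ?fpos.
exact/has_partialP/((f2 Wy a).2 e).
Qed.

Lemma factor_gt0 y : W y -> 0 < factor y.
Proof. by move=> Wy; rewrite powR_gt0 ?fpos. Qed.

Lemma is_partial_factor y a : W y ->
  is_partial phi a y (fun z => factor z) (2 * factor y * w y a).
Proof.
move=> Wy; have fy := fpos Wy.
have := is_partial_comp (h := fun s => s `^ q) (is_derive1_powR q fy)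
  (is_partial_f (a := a) Wy).
have fy0 : f y != 0 by rewrite gt_eqF.
apply: is_partial_ext => //; rewrite powRB ?fy0 ?implybT// powRr1 ?ltW//.
by rewrite /w; field.
Qed.

Lemma ginv_conformal y a b : W y ->
  ginv gt phi a b y = (factor y)^-1 * H y a b.
Proof.
move=> Wy; have fy := factor_gt0 Wy.
rewrite /ginv /conformal_metric invmxZ ?mxE// unitmxE detZ unitfE.
by rewrite mulf_neq0 ?expf_neq0 ?gt_eqF ?gdet.
Qed.

Lemma is_partial_conformal_metric y a b c : W y ->
  is_partial phi a y (fun z => gt phi z b c)
    (factor y * (2 * w y a * G y b c + dg y a b c)).
Proof.
move=> Wy.
have := is_partialM (is_partial_factor (a := a) Wy)
  (@is_partial_metric y a b c Wy).
apply: is_partial_ext => [z|]; first by rewrite /conformal_metric mxE.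
by rewrite /G; ring.
Qed.

Lemma christoffel_conformal y c a b : W y ->
  christoffel gt phi c a b y
  = gamma (H y) (dg y) c a b + conn_shift (G y) (H y) (w y) c a b.
Proof.
move=> Wy; have fy : factor y != 0 by rewrite gt_eqF ?factor_gt0.
have Hdelta e : \sum_d H y c d * G y e d = (c == e)%:R.
  rewrite eq_sym -(metric_ginv _ _ Wy); apply: eq_bigr => d _.
  by rewrite (ginv_sym _ _ Wy) mulrC.
transitivity (gamma (H y) (dg y) c a b
   + ((\sum_d H y c d * G y a d) * w y b + (\sum_d H y c d * G y b d) * w y a
   - G y a b * raise (H y) (w y) c)); last by rewrite !Hdelta.
rewrite /christoffel /gamma /raise !big_distrr !big_distrl -big_split -sumrB.
rewrite -big_split; apply: eq_bigr => d _ /=.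
rewrite ginv_conformal//.
rewrite !(fun i j k =>
  is_partialE (Wphi Wy) (@is_partial_conformal_metric y i j k Wy)).
rewrite /upper_metric /lower_metric /dlower_metric.
move: (f y `^ q) fy (ginv _ _ _ _ _) (w y) (g phi y) => C C0 h om gy.
move: (partial _ a _ _) (partial _ b _ _) (partial _ d _ _) => da db dd.
by field.
Qed.

Definition draise_at (y : M) := draise (H y) (dH y) (w y) (dw y).

Lemma is_partial_raise y e c : W y ->
  is_partial phi e y (fun z => raise (H z) (w z) c) (draise_at y e c).
Proof.
move=> Wy; apply: is_partial_sum => d.
by apply: is_partialM; [exact: is_partial_ginv|exact: is_partial_log_slope].
Qed.

Lemma partial_christoffel_conformal y e c a b : W y ->
  partial phi e (christoffel gt phi c a b) y
  = partial phi e (christoffel g phi c a b) y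
    + dconn_shift (G y) (H y) (dg y) (dH y) (w y) (dw y) e c a b.
Proof.
move=> Wy; apply: is_partialE; first exact: Wphi.
have slope := is_partial_log_slope.
have := is_partialD (@is_partial_christoffel y e c a b Wy)
  (is_partialB (is_partialD (is_partialZ (k := (c == a)%:R) (slope y e b Wy))
                            (is_partialZ (k := (c == b)%:R) (slope y e a Wy)))
     (is_partialM (@is_partial_metric y e a b Wy)
                  (@is_partial_raise y e c Wy))).
apply: (is_partial_local (Wphi Wy) oW Wy) => z Wz.
by rewrite christoffel_conformal.
Qed.

(** The divergence |g|^(-1/2) d_a (|g|^(1/2) w^a), expanded. *)
Definition div_slope (y : M) : R :=
  \sum_a draise_at y a a
  + \sum_a half_trace (H y) (dg y) a * raise (H y) (w y) a.

(** [conformal_curvature_trace] for the Christoffel symbols of the two metrics;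
    the factor f^q comes from the inverse metric in the trace. *)
Lemma scalar_curvature_log_slope y : W y ->
  factor y * scalar_curvature gt phi y = scalar_curvature g phi y
   - 2 * (n%:R - 1) * div_slope y - (n%:R - 1) * (n%:R - 2) * norm2 (H y) (w y).
Proof.
move=> Wy; have fy : factor y != 0 by rewrite gt_eqF ?factor_gt0.
rewrite -[RHS]addrA -mulNr -mulNr -[RHS]addrC.
have := conformal_curvature_trace (fun a b => metric_sym a b Wy)
  (fun a b => ginv_sym a b Wy) (fun a b => metric_ginv a b Wy)
  (fun a b c => dmetric_sym a b c Wy) (fun a b c => dginvE a b c Wy)
  (w y) (dw y).
rewrite -/(draise_at y) -/(div_slope y) mulNr => <-.
rewrite /scalar_curvature big_distrr -big_split; apply: eq_bigr => c _ /=.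
rewrite big_distrr -big_split; apply: eq_bigr => b _ /=.
rewrite ginv_conformal// mulrA mulVKf// -mulrDr; congr (_ * _).
rewrite /ricci -big_split; apply: eq_bigr => a _ /=.
rewrite /riemann !partial_christoffel_conformal//.
under [X in _ + X = _]eq_bigr do rewrite !christoffel_conformal//.
rewrite opprD addrACA [RHS]addrACA; congr (_ + _); first exact: addrC.
rewrite -big_split /=.
by apply: eq_bigr => e _; rewrite !christoffelE; ring.
Qed.

Lemma partial_log_slope y a : q != 0 -> W y ->
  partial phi a f y = 2 / q * (f y * w y a).
Proof.
by move=> q0 Wy; rewrite /w; field; rewrite q0 gt_eqF ?fpos.
Qed.

(** By w_a = (q / 2) d_a f / f, the flux of f is (2 / q) f |g|^(1/2) w^a. *)
Lemma laplacian_log_slope y : q != 0 -> W y ->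
  laplacian g phi f y
  = - (2 / q * f y * (div_slope y + 2 / q * norm2 (H y) (w y))).
Proof.
move=> q0 Wy; have vy : vol g phi y != 0 by rewrite gt_eqF ?vol_gt0.
have fluxE a z : W z ->
    2 / q * (vol g phi z * (raise (H z) (w z) a * f z)) = flux f a z.
  move=> Wz; rewrite /flux mulrCA; congr (_ * _).
  rewrite /raise big_distrl big_distrr; apply: eq_bigr => b _ /=.
  by rewrite (partial_log_slope _ q0 Wz) /upper_metric; ring.
have dflux a : partial phi a (flux f a) y = vol g phi y * (2 / q * f y *
    (half_trace (H y) (dg y) a * raise (H y) (w y) a + draise_at y a a
     + 2 / q * (w y a * raise (H y) (w y) a))).
  apply: is_partialE; first exact: Wphi.
  have := is_partialZ (k := 2 / q) (is_partialM (is_partial_vol (a := a) Wy)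
    (is_partialM (@is_partial_raise y a a Wy) (is_partial_f (a := a) Wy))).
  move/(is_partial_local (Wphi Wy) oW Wy (fluxE a)).
  by apply: is_partial_ext => //; rewrite (partial_log_slope _ q0 Wy); ring.
rewrite laplacianE; under eq_bigr do rewrite dflux.
rewrite -!big_distrr /= mulKf// !big_split /= -big_distrr /= -/(norm2 _ _).
by rewrite [X in X + _]addrC.
Qed.

(** With q (n - 2) = 4 the combination of div w and |w|^2 in
    [scalar_curvature_log_slope] is proportional to the one in
    [laplacian_log_slope]. *)
Lemma scalar_curvature_conformal y : (3 <= n)%N -> q * (n%:R - 2) = 4 -> W y ->
  (n%:R - 2) / (4 * (n%:R - 1)) * (f y * factor y * scalar_curvature gt phi y)
  = conformal_laplacian g phi f y.
Proof.
move=> n3 qn Wy.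
have n2 : (n%:R - 2 : R) != 0 by rewrite subr_eq0 eqr_nat gtn_eqF.
have n1 : (n%:R - 1 : R) != 0.
  by rewrite subr_eq0 (eqr_nat _ _ 1) gtn_eqF// ltnW.
have qE : q = 4 / (n%:R - 2) by rewrite -qn mulfK.
have q0 : q != 0 by rewrite qE mulf_neq0 ?invr_eq0// pnatr_eq0.
rewrite -(mulrA (f y)) scalar_curvature_log_slope// /conformal_laplacian.
rewrite laplacian_log_slope//.
have -> : 2 / q = (n%:R - 2) / 2 by rewrite qE; field.
by field.
Qed.

(** By q (n - 2) = 4, f^(q n) is the square of f^q f^2. *)
Lemma vol_conformal y : q * (n%:R - 2) = 4 -> W y ->
  vol gt phi y = factor y * f y ^+ 2 * vol g phi y.
Proof.
move=> qn Wy; have fy := fpos Wy; have fq := factor_gt0 Wy.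
have -> : vol gt phi y = Num.sqrt (factor y ^+ n * \det (g phi y)).
  by rewrite /vol /conformal_metric detZ.
have -> : factor y ^+ n = (factor y * f y ^+ 2) ^+ 2.
  rewrite -powR_mulrn ?ltW// -powRrM exprMn -exprM -[in RHS]powR_mulrn ?ltW//.
  rewrite -powRrM -powR_mulrn ?ltW// -powRD ?(gt_eqF fy) ?implybT//.
  congr (_ `^ _); move: qn; rewrite mulrBr => /eqP.
  by rewrite subr_eq => /eqP ->; ring.
by rewrite sqrtrM ?sqr_ge0// sqrtr_sqr ger0_norm// mulr_ge0 ?ltW// exprn_gt0.
Qed.

(** The flux of u for the metric f^q g is f^2 times its flux V(u) for g, and
    V(f u) = f V(u) + u V(f). Since d_a u V^a(f) = d_a f V^a(u), both sides
    contain the term 2 f d_a f V^a(u) besides f^2 times the divergence of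
    V(u). *)
Lemma laplacian_conformal u y :
  q * (n%:R - 2) = 4 -> twice_partial phi W u -> W y ->
  factor y * f y ^+ 2 * laplacian gt phi u y
  = f y * laplacian g phi (fun z => f z * u z) y
    - f y * u y * laplacian g phi f y.
Proof.
move=> qn u2 Wy; pose F z := f z * u z.
have F2 : twice_partial phi W F by exact: twice_partialM.
have fy := fpos Wy; have fq := factor_gt0 Wy; have vy := vol_gt0 Wy.
have ux z b (Wz : W z) := has_partialP (u2 z Wz b).1.
have dF z b : W z ->
    partial phi b F z = partial phi b f z * u z + f z * partial phi b u z.
  move=> Wz; apply: is_partialE; first exact: Wphi.
  exact: is_partialM (is_partial_f Wz) (ux z b Wz).
pose tflux a z := vol gt phi z * \sum_b ginv gt phi a b z * partial phi b u z.
have tfluxE a z : W z -> f z ^+ 2 * flux u a z = tflux a z.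
  move=> Wz; have fqz : factor z != 0 by rewrite gt_eqF ?factor_gt0.
  rewrite /tflux /flux vol_conformal//.
  under [in RHS]eq_bigr do rewrite ginv_conformal// -mulrA.
  by rewrite -big_distrr /=; field.
have FfluxE a z : W z -> f z * flux u a z + u z * flux f a z = flux F a z.
  move=> Wz; rewrite /flux mulrCA (mulrCA (u z)) -mulrDr; congr (_ * _).
  rewrite !big_distrr -big_split; apply: eq_bigr => b _ /=.
  by rewrite dF//; ring.
have dflux a v (v2 : twice_partial phi W v) := @is_partial_flux v a y v2 Wy.
have df a := is_partial_f (a := a) Wy.
have dtflux a : partial phi a (tflux a) y =
    2 * f y * partial phi a f y * flux u a y
    + f y ^+ 2 * partial phi a (flux u a) y.
  apply: is_partialE; first exact: Wphi.
  apply: (is_partial_local (Wphi Wy) oW Wy (tfluxE a)).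
  apply: is_partial_ext
    (is_partialM (is_partialM (df a) (df a)) (dflux a _ u2)) => //.
  by rewrite expr2; ring.
have dFflux a : partial phi a (flux F a) y =
    partial phi a f y * flux u a y + f y * partial phi a (flux u a) y
    + (partial phi a u y * flux f a y + u y * partial phi a (flux f a) y).
  apply: is_partialE; first exact: Wphi.
  apply: (is_partial_local (Wphi Wy) oW Wy (FfluxE a)).
  exact: is_partialD (is_partialM (df a) (dflux a _ u2))
    (is_partialM (ux y a Wy) (dflux a _ f2)).
have cross : \sum_a partial phi a u y * flux f a y
           = \sum_a partial phi a f y * flux u a y.
  rewrite /flux; under eq_bigr do rewrite mulrCA big_distrr /=.
  under [RHS]eq_bigr do rewrite mulrCA big_distrr /=.
  rewrite -!big_distrr exchange_big; congr (_ * _); apply: eq_bigr => a _ /=.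
  apply: eq_bigr => b _; rewrite -[ginv g phi b a y]/(H y b a) ginv_sym//.
  by rewrite /upper_metric; ring.
pose X := \sum_a partial phi a f y * flux u a y.
have sum_tflux : \sum_a partial phi a (tflux a) y =
    2 * f y * X + f y ^+ 2 * \sum_a partial phi a (flux u a) y.
  rewrite /X !big_distrr -big_split; apply: eq_bigr => a _ /=.
  by rewrite dtflux -mulrA.
have sum_Fflux : \sum_a partial phi a (flux F a) y =
    X + f y * \sum_a partial phi a (flux u a) y
    + (X + u y * \sum_a partial phi a (flux f a) y).
  rewrite -[Y in _ = _ + (Y + _)]cross /X !big_distrr -!big_split.
  by apply: eq_bigr => a _ /=; exact: dFflux.
have lapl_u : laplacian gt phi u y = - ((factor y * f y ^+ 2 * vol g phi y)^-1 *
    (2 * f y * X + f y ^+ 2 * \sum_a partial phi a (flux u a) y)).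
  by rewrite -vol_conformal// -sum_tflux.
have lapl_F : laplacian g phi (fun z => f z * u z) y = - ((vol g phi y)^-1 *
    (X + f y * \sum_a partial phi a (flux u a) y
     + (X + u y * \sum_a partial phi a (flux f a) y))).
  by rewrite -sum_Fflux.
rewrite lapl_u lapl_F (laplacianE f).
have alg (v C s t U V : R) : v != 0 -> C != 0 -> s != 0 ->
    C * s ^+ 2 * - ((C * s ^+ 2 * v)^-1 * (2 * s * X + s ^+ 2 * U)) =
    s * - (v^-1 * (X + s * U + (X + t * V))) - s * t * - (v^-1 * V).
  by move=> v0 C0 s0; field; rewrite v0 C0 s0.
by apply: alg; exact: lt0r_neq0.
Qed.

End ConformalChange.

End ChartGeometry.

(** * Conformal harmonic coordinates *)

Section Atlas.
Context {R : realType} {n : nat} {M : topologicalType}.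
Variables (r : R) (A : set (chart R n M)) (g : tensor2 R n M) (Omega : set M).
Hypotheses (r2 : 2 < r) (oOmega : open Omega).

Lemma chart_class_twice_partial (phi : chart R n M) (W : set M) (s : R) u :
  open W -> W `<=` chart_dom phi -> 2 <= s ->
  chart_class phi W s u -> twice_partial phi W u.
Proof.
move=> oW Wphi s2; apply: holder_class_twice_partial => //.
by rewrite truncn_ge_nat// (le_trans _ s2).
Qed.

Lemma chart_class2 (phi : chart R n M) (W : set M) u :
  chart_class phi W 2 u <-> holder_class phi W 2 0 u.
Proof. by rewrite /chart_class natrK subrr. Qed.

Lemma chart_class_le2 (phi : chart R n M) (W : set M) (s : R) u :
  open W -> W `<=` chart_dom phi -> 2 <= s ->
  chart_class phi W s u -> chart_class phi W 2 u.
Proof.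
move=> oW Wphi s2 su; apply/chart_class2; move: su.
apply: holder_class_le => //.
by rewrite truncn_ge_nat// (le_trans _ s2).
Qed.

Section OneChart.
Variables (phi : chart R n M).
Hypothesis (gR : riemannian_metric A r g) (Aphi : A phi).
Let W := Omega `&` chart_dom phi.

Lemma chart_piece_open : open W.
Proof. by apply: openI => //; exact: chart_dom_open. Qed.

Lemma chart_piece_sub : W `<=` chart_dom phi. Proof. by move=> y []. Qed.

Lemma riemannian_sym y : W y -> (g phi y)^T = g phi y.
Proof. by case=> _ ?; case: gR => + _ _ _; exact. Qed.

Lemma riemannian_det_gt0 y : W y -> 0 < \det (g phi y).
Proof.
by case=> _ phiy; apply: posdef_det_gt0 => v v0; case: gR => _ + _ _; exact.
Qed.

Lemma riemannian_twice_partial b c : twice_partial phi W (fun y => g phi y b c).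
Proof.
case: gR => _ _ _ /(_ phi b c Aphi) gr.
have H := chart_class_twice_partial (chart_dom_open phi)
  (@subset_refl _ _) (ltW r2) gr.
by move=> y [_ phiy]; exact: H.
Qed.

End OneChart.

Section Conformal.
Variables (f : M -> R) (p : R).
Hypotheses (n3 : (3 <= n)%N) (pE : p = 2 * n%:R / (n%:R - 2)).
Hypothesis gR : riemannian_metric A r g.
Hypotheses (f2 : class_on A Omega 2 f) (fpos : forall x, Omega x -> 0 < f x).

Local Notation gt := (conformal_metric (fun x => f x `^ (p - 2)) g).

Let n2 : (n%:R - 2 : R) != 0.
Proof. by rewrite subr_eq0 eqr_nat gtn_eqF. Qed.

Let n1 : (n%:R - 1 : R) != 0.
Proof. by rewrite subr_eq0 (eqr_nat _ _ 1) gtn_eqF// ltnW. Qed.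

Lemma critical_exponent : (p - 2) * (n%:R - 2) = 4.
Proof. by rewrite pE; field. Qed.

Lemma class_on_twice_partial phi u : A phi -> class_on A Omega 2 u ->
  twice_partial phi (Omega `&` chart_dom phi) u.
Proof.
move=> Aphi u2; apply: chart_class_twice_partial (u2 phi Aphi) => //.
exact: chart_piece_open.
Qed.

Lemma vanishing_scalar_curvature :
  vanishes A Omega (scalar_curvature gt) <->
  vanishes A Omega (fun phi => conformal_laplacian g phi f).
Proof.
suff H phi x : A phi -> Omega x -> chart_dom phi x ->
    (scalar_curvature gt phi x = 0 <-> conformal_laplacian g phi f x = 0).
  by split=> H0 phi x Aphi Ox phix; apply/H => //; exact: H0.
move=> Aphi Ox phix; have Wx : (Omega `&` chart_dom phi) x by [].
rewrite -(scalar_curvature_conformal (chart_piece_open phi)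
  (@chart_piece_sub phi)
  (riemannian_sym gR Aphi) (riemannian_det_gt0 gR Aphi)
  (riemannian_twice_partial gR Aphi)
  (fun y Wy => fpos Wy.1) (class_on_twice_partial Aphi f2) n3
  critical_exponent Wx).
have fx : f x * f x `^ (p - 2) != 0.
  by rewrite mulf_neq0 ?gt_eqF ?powR_gt0 ?fpos.
split=> [->|/eqP]; first by rewrite !mulr0.
have cn : (n%:R - 2) / (4 * (n%:R - 1)) != 0 :> R.
  by rewrite mulf_neq0 ?invr_eq0 ?mulf_neq0 ?pnatr_eq0.
by rewrite mulf_eq0 (negPf cn) /= mulf_eq0 (negPf fx) => /eqP.
Qed.

(** If L_g f = 0 then f Delta_g (f u) - f u Delta_g f = f L_g (f u), as the
    scalar curvature terms cancel. *)
Lemma vanishing_laplacian u :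
  (forall phi, A phi -> twice_partial phi (Omega `&` chart_dom phi) u) ->
  vanishes A Omega (fun phi => conformal_laplacian g phi f) ->
  vanishes A Omega (fun phi => laplacian gt phi u) <->
  vanishes A Omega (fun phi => conformal_laplacian g phi (fun x => f x * u x)).
Proof.
move=> u2 Lf.
suff H phi x : A phi -> Omega x -> chart_dom phi x ->
    (laplacian gt phi u x = 0 <->
     conformal_laplacian g phi (fun x => f x * u x) x = 0).
  by split=> H0 phi x Aphi Ox phix; apply/H => //; exact: H0.
move=> Aphi Ox phix; have Wx : (Omega `&` chart_dom phi) x by [].
have := laplacian_conformal (chart_piece_open phi) (@chart_piece_sub phi)
  (riemannian_sym gR Aphi) (riemannian_det_gt0 gR Aphi)
  (riemannian_twice_partial gR Aphi)
  (fun y Wy => fpos Wy.1) (class_on_twice_partial Aphi f2) critical_exponent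
  (u2 phi Aphi) Wx.
have := Lf phi x Aphi Ox phix; rewrite /conformal_laplacian.
move: (laplacian g phi f x) (laplacian g phi (fun z => f z * u z) x)
  (laplacian gt phi u x).
move: (_ / _ * scalar_curvature g phi x) => K Lf0 L Lu /eqP.
rewrite addr_eq0 => /eqP -> Luu.
have fx := fpos Ox; have fqx : 0 < f x `^ (p - 2) by rewrite powR_gt0.
have {}Luu : f x `^ (p - 2) * f x ^+ 2 * Lu = f x * (L + K * (f x * u x)).
  by rewrite Luu; ring.
split=> [Lu0|L0].
  move: Luu; rewrite Lu0 mulr0 => /esym/eqP.
  by rewrite mulf_eq0 (gt_eqF fx) => /eqP.
move: Luu; rewrite L0 mulr0 => /eqP.
by rewrite mulf_eq0 gt_eqF ?mulr_gt0 ?exprn_gt0// => /eqP.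
Qed.

End Conformal.

Lemma coordinate_chart_class (Z phi : chart R n M) (k : 'I_n) :
  is_manifold (r + 1) A -> coordinates_on A Omega Z -> A phi ->
  chart_class phi (Omega `&` chart_dom phi) (r + 1) (fun x => Z x ord0 k).
Proof.
move=> [_ _ + _] [AZ domZ] Aphi => /(_ phi Z Aphi AZ k).
by rewrite domZ setIC.
Qed.

End Atlas.

Theorem proposition2p4 (R : realType) (n : nat) (M : topologicalType) (r p : R)
    (A : set (chart R n M)) (g : tensor2 R n M)
    (Omega : set M) (Z : chart R n M) :
  (3 <= n)%N ->
  2 < r ->
  is_manifold (r + 1) A ->
  riemannian_metric A r g ->
  p = 2 * n%:R / (n%:R - 2) ->
  open Omega ->
  coordinates_on A Omega Z ->
  conformal_harmonic_coordinates A g Omega Z <->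
  exists f : M -> R,
    [/\ class_on A Omega 2 f,
        forall x, Omega x -> 0 < f x,
        harmonic_coordinates A
          (conformal_metric (fun x => f x `^ (p - 2)) g) Omega Z
      & vanishes A Omega (scalar_curvature
          (conformal_metric (fun x => f x `^ (p - 2)) g))].
Proof.
move=> n3 r2 Mfd gR pE oOmega coordZ.
pose W (phi : chart R n M) := Omega `&` chart_dom phi.
have oW phi : open (W phi) by exact: chart_piece_open.
have Wphi phi : W phi `<=` chart_dom phi by exact: chart_piece_sub.
have r12 : 2 <= r + 1 by rewrite (le_trans (ltW r2))// lerDl.
have Z2 k phi : A phi -> twice_partial phi (W phi) (fun x => Z x ord0 k).
  move=> Aphi; apply: (chart_class_twice_partial (oW phi) (@Wphi phi) r12).
  exact: (coordinate_chart_class k Mfd coordZ Aphi).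
split.
  case=> _ [F] [f] [[f2 F2] fpos ZE LF Lf]; exists f; split=> //; last first.
    exact/(vanishing_scalar_curvature r2 oOmega n3 pE gR f2 fpos).
  split=> // k.
  apply/(vanishing_laplacian r2 oOmega n3 pE gR f2 fpos (Z2 k) Lf).
  have FE x : Omega x -> F k x = f x * Z x ord0 k.
    by move=> Ox; rewrite ZE// mulrC divfK// gt_eqF ?fpos.
  move=> phi x Aphi Ox phix; have := LF k phi x Aphi Ox phix.
  have FkE z : W phi z -> F k z = f z * Z z ord0 k by case=> Oz _; exact: FE.
  have lapl := laplacian_local (oW phi) (@Wphi phi)
    (riemannian_det_gt0 gR Aphi) (riemannian_twice_partial r2 gR Aphi)
    (class_on_twice_partial oOmega Aphi (F2 k)) FkE (conj Ox phix).
  by rewrite /conformal_laplacian lapl (FE x Ox).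
case=> f [f2 fpos [_ LZ] scal0]; split=> //.
have Lf := (vanishing_scalar_curvature r2 oOmega n3 pE gR f2 fpos).1 scal0.
exists (fun k x => f x * Z x ord0 k), f; split=> //.
- split=> // k phi Aphi; apply/chart_class2.
  apply: (holder_classM (oW phi) (@Wphi phi)); first exact/chart_class2/f2.
  apply/chart_class2/(chart_class_le2 (oW phi) (@Wphi phi) r12).
  exact: (coordinate_chart_class k Mfd coordZ Aphi).
- by move=> k x Ox; rewrite [f x * _]mulrC mulfK// gt_eqF ?fpos.
- move=> k.
  by apply/(vanishing_laplacian r2 oOmega n3 pE gR f2 fpos (Z2 k) Lf).
Qed.
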